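(* Let $G_1$ and $G_2$ be finite simple graphs, where $G_i$ has $n_i$ vertices, $m_i$ edges, minimum degree $\delta_{G_i}$ and maximum degree $\Delta_{G_i}$ ($i=1,2$). Then $\alpha_1 \leq ESO(G_1+G_2)\leq \alpha_2$, where $$\alpha_1=2\sqrt{2}\,m_1(\delta_{G_1}+n_2)^2+2\sqrt{2}\,m_2(\delta_{G_2}+n_1)^2+n_1n_2(\delta_{G_1}+n_2+\delta_{G_2}+n_1)\{(\delta_{G_1}+n_2)^2+(\delta_{G_2}+n_1)^2\}^{\frac{1}{2}},$$ $$\alpha_2=2\sqrt{2}\,m_1(\Delta_{G_1}+n_2)^2+2\sqrt{2}\,m_2(\Delta_{G_2}+n_1)^2+n_1n_2(\Delta_{G_1}+n_2+\Delta_{G_2}+n_1)\{(\Delta_{G_1}+n_2)^2+(\Delta_{G_2}+n_1)^2\}^{\frac{1}{2}}.$$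
   Context: For a graph $G$ and vertex $u$, $d(u)$ denotes the degree of $u$ in $G$. The elliptic Sombor index of a graph $G$ is $ESO(G)=\sum_{uv\in E(G)}(d(u)+d(v))\sqrt{d(u)^2+d(v)^2}$. The join $G_1+G_2$ of graphs $G_1=(V_1,E_1)$ and $G_2=(V_2,E_2)$ (with disjoint vertex sets) is the graph with vertex set $V_1\cup V_2$ and edge set $E_1\cup E_2\cup\{v_1v_2: v_1\in V_1, v_2\in V_2\}$. *)

(* Defs.v *)
From mathcomp Require Import all_boot all_order all_algebra.

Set Implicit Arguments.
Unset Strict Implicit.
Unset Printing Implicit Defensive.

Import Order.TTheory GRing.Theory Num.Theory.

Record sgraph := SGraph {
  vertex :> finType;
  adj : rel vertex;
  adj_sym : symmetric adj;
  adj_irrefl : irreflexive adj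
}.

Definition edges (G : sgraph) : {set {set G}} :=
  [set [set p.1; p.2] | p : G * G & adj p.1 p.2].

Definition degree (G : sgraph) (u : G) : nat := #|[set v : G | adj u v]|.

(* A degree is less than #|G|, so the default value #|G| matters only for the
   graph without vertices, whose minimum degree is then 0. *)
Definition min_degree (G : sgraph) : nat :=
  \big[minn/#|G|]_(u : G) degree u.

Definition max_degree (G : sgraph) : nat := \max_(u : G) degree u.

Section Join.
Variables G1 G2 : sgraph.

Definition join_adj (x y : G1 + G2) : bool :=
  match x, y with
  | inl u, inl v => adj u v
  | inr u, inr v => adj u v
  | _, _ => true
  end.

Lemma join_adj_sym : symmetric join_adj.
Proof. by move=> [x|x] [y|y] //=; apply: adj_sym. Qed.

Lemma join_adj_irrefl : irreflexive join_adj.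
Proof. by move=> [x|x] /=; apply: adj_irrefl. Qed.

Definition join : sgraph := SGraph join_adj_sym join_adj_irrefl.

End Join.

Local Open Scope ring_scope.

(* An edge e = {u, v} is a two-element set, so the sums over the vertices of e
   are d(u) + d(v) and d(u)^2 + d(v)^2; see eso_weightE. *)
Definition eso_weight (R : rcfType) (G : sgraph) (e : {set G}) : R :=
  (\sum_(u in e) (degree u)%:R) * Num.sqrt (\sum_(u in e) (degree u)%:R ^+ 2).

Definition ESO (R : rcfType) (G : sgraph) : R :=
  \sum_(e in edges G) eso_weight R e.

Lemma eso_weightE (R : rcfType) (G : sgraph) (u v : G) : adj u v ->
  eso_weight R [set u; v] =
  ((degree u)%:R + (degree v)%:R)
    * Num.sqrt ((degree u)%:R ^+ 2 + (degree v)%:R ^+ 2).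
Proof.
move=> uv; have neq_uv : u \notin [set v].
  by rewrite inE; apply: contraTneq uv => ->; rewrite adj_irrefl.
by rewrite /eso_weight !big_setU1 // !big_set1.
Qed.

(* Main.v *)
(* In the join every degree of G1 grows by #|G2| and conversely, and the edges
   are those of G1, those of G2, and one for each pair in G1 * G2. The edge
   weight is nondecreasing in both degrees, so replacing all degrees by their
   extremes bounds each of the three partial sums; on edges inside one factor the
   two arguments coincide, which gives the coefficient 2 * sqrt 2. *)
Require Import Defs.
From mathcomp Require Import all_boot all_order all_algebra.
Import Order.TTheory GRing.Theory Num.Theory.
Local Open Scope ring_scope.

(** Counting over the sum type splits the neighbours of [inl u] into those of [u] in [G1] and all
    vertices of [G2]. *)
Lemma degree_join_inl (G1 G2 : sgraph) (u : G1) :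
  degree (inl u : join G1 G2) = (degree u + #|G2|)%N.
Proof. by rewrite /degree !cardsE -!sum1_card big_sumType. Qed.

Lemma degree_join_inr (G1 G2 : sgraph) (v : G2) :
  degree (inr v : join G1 G2) = (degree v + #|G1|)%N.
Proof. by rewrite /degree !cardsE -!sum1_card big_sumType addnC. Qed.

Lemma min_degree_le (G : sgraph) (u : G) : (min_degree G <= degree u)%N.
Proof. by rewrite /min_degree -minEnat; exact: (@bigmin_le _ nat). Qed.

Lemma max_degree_ge (G : sgraph) (u : G) : (degree u <= max_degree G)%N.
Proof. exact: leq_bigmax. Qed.

Lemma edgesP (G : sgraph) (e : {set G}) :
  reflect (exists u v, adj u v /\ e = [set u; v]) (e \in edges G).
Proof.
apply: (iffP imsetP) => [[[u v]]|[u [v [uv ->]]]]; last first.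
  by exists (u, v); rewrite ?inE.
by rewrite inE /= => uv ->; exists u, v.
Qed.

Lemma sum_setU_disjoint (V : nmodType) (T : finType) (A B : {set T})
    (F : T -> V) : [disjoint A & B] ->
  \sum_(x in A :|: B) F x = \sum_(x in A) F x + \sum_(x in B) F x.
Proof. by move=> dAB; rewrite -bigU //; apply: eq_bigl => x; rewrite !inE. Qed.

Section Join.
Variables G1 G2 : sgraph.

(** Edges are vertex sets, so edges of a factor embed by direct image; this lets sums over edges of
    the join be reindexed by the factors. *)
Definition left_edge (e : {set G1}) : {set join G1 G2} := inl @: e.
Definition right_edge (e : {set G2}) : {set join G1 G2} := inr @: e.
Definition cross_edge (p : G1 * G2) : {set join G1 G2} :=
  [set inl p.1; inr p.2].

Lemma left_edge2 (u v : G1) : left_edge [set u; v] = [set inl u; inl v].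
Proof. by rewrite /left_edge imsetU1 imset_set1. Qed.

Lemma right_edge2 (u v : G2) : right_edge [set u; v] = [set inr u; inr v].
Proof. by rewrite /right_edge imsetU1 imset_set1. Qed.

Lemma edges_join :
  edges (join G1 G2) =
  left_edge @: edges G1 :|: right_edge @: edges G2 :|: cross_edge @: [set: G1 * G2].
Proof.
apply/setP => e; rewrite !inE; apply/edgesP/idP.
  case=> [[u|u]] [[v|v]] /= [uv ->].
  - apply/orP; left; apply/orP; left; apply/imsetP; exists [set u; v].
      by apply/edgesP; exists u, v.
    by rewrite left_edge2.
  - by apply/orP; right; apply/imsetP; exists (u, v); rewrite ?in_setT.
  (* [cross_edge] expects the endpoint in [G1] first, so the pair is swapped; the edge itself is
     unordered. *)
  - apply/orP; right; apply/imsetP; exists (v, u); rewrite ?in_setT //.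
    by rewrite /cross_edge setUC.
  - apply/orP; left; apply/orP; right; apply/imsetP; exists [set u; v].
      by apply/edgesP; exists u, v.
    by rewrite right_edge2.
case/orP => [/orP[] /imsetP[_ /edgesP[u [v [uv ->]]] ->]|/imsetP[[u v] _ ->]].
- by exists (inl u), (inl v); rewrite left_edge2.
- by exists (inr u), (inr v); rewrite right_edge2.
- by exists (inl u), (inr v).
Qed.

Lemma left_edge_inj : injective left_edge.
Proof. by apply: imset_inj => x y []. Qed.

Lemma right_edge_inj : injective right_edge.
Proof. by apply: imset_inj => x y []. Qed.

(** The tags [inl] and [inr] tell the two endpoints apart, so the unordered edge still determines
    the ordered pair. *)
Lemma cross_edge_inj : injective cross_edge.
Proof.
move=> [u v] [u' v'] /setP eq_cross.
have := eq_cross (inl u); have := eq_cross (inr v).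
by rewrite !inE /= !eqxx /= => /esym/eqP[->] /esym; rewrite orbF => /eqP[->].
Qed.

(** The three families of edges are pairwise disjoint and each is parametrised injectively. *)
Lemma big_edges_join (R : nmodType) (F : {set join G1 G2} -> R) :
  \sum_(e in edges (join G1 G2)) F e =
  \sum_(e in edges G1) F (left_edge e) + \sum_(e in edges G2) F (right_edge e)
  + \sum_(p : G1 * G2) F (cross_edge p).
Proof.
rewrite edges_join !sum_setU_disjoint.
- rewrite (big_imset _ (in2W left_edge_inj)) (big_imset _ (in2W right_edge_inj)).
  rewrite (big_imset _ (in2W cross_edge_inj)) /=; congr (_ + _).
  by apply: eq_bigl => p; rewrite inE.
(* A left edge contains some [inl u], which no right edge does. *)
- rewrite -setI_eq0; apply/eqP/setP => e; rewrite !inE; apply/negP => /andP[].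
  move=> /imsetP[_ /edgesP[u [v [_ ->]]] ->] /imsetP[f _].
  by move/setP/(_ (inl u)); rewrite left_edge2 !inE eqxx => /esym/imsetP[].
- rewrite -setI_eq0; apply/eqP/setP => e; rewrite !inE; apply/negP => /andP[].
  (* A cross edge has endpoints on both sides: its [inr v] lies in no left edge, its [inl u] in no
     right edge. *)
  case/orP => /imsetP[f _ ->] /imsetP[[u v] _ /setP eq_e].
    have := eq_e (inr v); rewrite !inE eqxx orbT.
    by case/imsetP.
  by have := eq_e (inl u); rewrite !inE eqxx; case/imsetP.
Qed.

End Join.

Section Weight.
Variable R : rcfType.

(** The edge weight as a function of two real arguments, so that degrees can be replaced by
    bounds. *)
Definition weight (a b : R) : R := (a + b) * Num.sqrt (a ^+ 2 + b ^+ 2).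

Lemma le_weight (a b c d : R) :
  0 <= a -> 0 <= b -> a <= c -> b <= d -> weight a b <= weight c d.
Proof.
move=> a0 b0 ac bd; have c0 := le_trans a0 ac; have d0 := le_trans b0 bd.
apply: ler_pM; rewrite ?sqrtr_ge0 ?addr_ge0 ?lerD //.
by apply: ler_wsqrtr; rewrite lerD ?lerXn2r.
Qed.

(** The root of [2 * a ^+ 2] is [Num.sqrt 2] times the absolute value of [a], which is [a] by the
    sign hypothesis. *)
Lemma weight_diag (a : R) : 0 <= a -> weight a a = 2 * Num.sqrt 2 * a ^+ 2.
Proof.
move=> a0; rewrite /weight -(mulr2n a) -(mulr2n (a ^+ 2)) -(mulr_natl a).
rewrite -(mulr_natl (a ^+ 2)) sqrtrM ?ler0n // sqrtr_sqr ger0_norm //.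
by rewrite mulrACA -expr2.
Qed.

Variables G1 G2 : sgraph.

Let dl (u : G1) : R := (degree u)%:R + #|G2|%:R.
Let dr (v : G2) : R := (degree v)%:R + #|G1|%:R.

Lemma eso_weight_join_ll (u v : G1) : adj u v ->
  eso_weight R [set (inl u : join G1 G2); inl v] = weight (dl u) (dl v).
Proof. by move=> uv; rewrite eso_weightE // !degree_join_inl !natrD. Qed.

Lemma eso_weight_join_rr (u v : G2) : adj u v ->
  eso_weight R [set (inr u : join G1 G2); inr v] = weight (dr u) (dr v).
Proof. by move=> uv; rewrite eso_weightE // !degree_join_inr !natrD. Qed.

Lemma eso_weight_join_lr (u : G1) (v : G2) :
  eso_weight R [set (inl u : join G1 G2); inr v] = weight (dl u) (dr v).
Proof. by rewrite eso_weightE // degree_join_inl degree_join_inr !natrD. Qed.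

(** Both bounds have this shape. As sums of constants over the three edge families they can be
    compared with [ESO] term by term. *)
Lemma ESO_join_const (a b : R) : 0 <= a -> 0 <= b ->
  2 * Num.sqrt 2 * #|edges G1|%:R * a ^+ 2
  + 2 * Num.sqrt 2 * #|edges G2|%:R * b ^+ 2
  + #|G1|%:R * #|G2|%:R * (a + b) * Num.sqrt (a ^+ 2 + b ^+ 2) =
  \sum_(e in edges G1) weight a a + \sum_(e in edges G2) weight b b
  + \sum_(p : G1 * G2) weight a b.
Proof.
move=> a0 b0; rewrite !sumr_const card_prod !weight_diag //.
rewrite -(mulr_natr (_ * a ^+ 2)) -(mulr_natr (_ * b ^+ 2)).
rewrite -(mulr_natl (weight a b)) natrM /weight !mulrA.
by rewrite !(mulrAC _ a #|edges G1|%:R) !(mulrAC _ b #|edges G2|%:R).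
Qed.

Lemma ESO_join_ge (a b : R) : 0 <= a -> 0 <= b ->
    (forall u, a <= dl u) -> (forall v, b <= dr v) ->
  \sum_(e in edges G1) weight a a + \sum_(e in edges G2) weight b b
  + \sum_(p : G1 * G2) weight a b <= ESO R (join G1 G2).
Proof.
move=> a0 b0 le_a le_b; rewrite /ESO big_edges_join.
apply: lerD; first apply: lerD; apply: ler_sum.
- move=> _ /edgesP[u [v [uv ->]]].
  by rewrite left_edge2 eso_weight_join_ll // le_weight.
- move=> _ /edgesP[u [v [uv ->]]].
  by rewrite right_edge2 eso_weight_join_rr // le_weight.
- by move=> [u v] _; rewrite eso_weight_join_lr le_weight.
Qed.

Lemma ESO_join_le (a b : R) : (forall u, dl u <= a) -> (forall v, dr v <= b) ->
  ESO R (join G1 G2) <=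
  \sum_(e in edges G1) weight a a + \sum_(e in edges G2) weight b b
  + \sum_(p : G1 * G2) weight a b.
Proof.
(* Monotonicity of [weight] requires the smaller arguments to be nonnegative; for the upper bound
   these are the degrees in the join. *)
have dl0 u : 0 <= dl u by rewrite addr_ge0.
have dr0 v : 0 <= dr v by rewrite addr_ge0.
move=> le_a le_b; rewrite /ESO big_edges_join.
apply: lerD; first apply: lerD; apply: ler_sum.
- move=> _ /edgesP[u [v [uv ->]]].
  by rewrite left_edge2 eso_weight_join_ll // le_weight.
- move=> _ /edgesP[u [v [uv ->]]].
  by rewrite right_edge2 eso_weight_join_rr // le_weight.
- by move=> [u v] _; rewrite eso_weight_join_lr le_weight.
Qed.

End Weight.

Theorem theorem1 (R : rcfType) (G1 G2 : sgraph) :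
  let n1 : R := #|G1|%:R in
  let n2 : R := #|G2|%:R in
  let m1 : R := #|edges G1|%:R in
  let m2 : R := #|edges G2|%:R in
  let d1 : R := (min_degree G1)%:R in
  let d2 : R := (min_degree G2)%:R in
  let D1 : R := (max_degree G1)%:R in
  let D2 : R := (max_degree G2)%:R in
  let alpha1 : R :=
    2 * Num.sqrt 2 * m1 * (d1 + n2) ^+ 2
    + 2 * Num.sqrt 2 * m2 * (d2 + n1) ^+ 2
    + n1 * n2 * (d1 + n2 + d2 + n1)
      * Num.sqrt ((d1 + n2) ^+ 2 + (d2 + n1) ^+ 2) in
  let alpha2 : R :=
    2 * Num.sqrt 2 * m1 * (D1 + n2) ^+ 2
    + 2 * Num.sqrt 2 * m2 * (D2 + n1) ^+ 2
    + n1 * n2 * (D1 + n2 + D2 + n1)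
      * Num.sqrt ((D1 + n2) ^+ 2 + (D2 + n1) ^+ 2) in
  alpha1 <= ESO R (join G1 G2) /\ ESO R (join G1 G2) <= alpha2.
Proof.
move=> n1 n2 m1 m2 d1 d2 D1 D2 alpha1 alpha2; split.
(* Regrouping the four summands exposes [a + b] with [a = d1 + n2] and [b = d2 + n1]. *)
- rewrite /alpha1 -[_ + d2 + n1]addrA ESO_join_const ?addr_ge0 //.
  by apply: ESO_join_ge; rewrite ?addr_ge0 // => u;
    rewrite lerD2r ler_nat min_degree_le.
- rewrite /alpha2 -[_ + D2 + n1]addrA ESO_join_const ?addr_ge0 //.
  by apply: ESO_join_le => u; rewrite lerD2r ler_nat max_degree_ge.
Qed.
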